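(* Let $\lambda_1,\lambda_2\in\mathbb{C}$ with $\Re(\lambda_1)\Re(\lambda_2)\ne0$. Then the constant coefficient system $$\bm{x}'=A\bm{x},\qquad A=\begin{pmatrix}\lambda_1&0\\0&\lambda_2\end{pmatrix},$$ is Ulam stable on $\mathbb{R}$, and the best Ulam constant is $K_{c1}:=\max\left\{\frac{1}{|\Re(\lambda_1)|},\frac{1}{|\Re(\lambda_2)|}\right\}$.
   Context: $\|(v_1,v_2)^T\|_\infty=\max\{|v_1|,|v_2|\}$ on $\mathbb{C}^2$, and $\Re(z)$ is the real part of $z$. For $A\in\mathbb{C}^{2\times2}$, the equation $\bm{x}'=A\bm{x}$ is called Ulam stable on $\mathbb{R}$ if there is a constant $K>0$ such that: for every $\varepsilon>0$ and every continuously differentiable $\bm{\phi}:\mathbb{R}\to\mathbb{C}^2$ with $\sup_{t\in\mathbb{R}}\|\bm{\phi}'(t)-A\bm{\phi}(t)\|_\infty\le\varepsilon$, there exists a solution $\bm{x}:\mathbb{R}\to\mathbb{C}^2$ of the equation with $\sup_{t\in\mathbb{R}}\|\bm{\phi}(t)-\bm{x}(t)\|_\infty\le K\varepsilon$. Any such $K$ is called an Ulam constant for the equation on $\mathbb{R}$. The best Ulam constant is the minimum of all Ulam constants, if this minimum exists. *)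

(* Defs.v *)
From Stdlib Require Export Reals.
From Coquelicot Require Export Coquelicot.

Open Scope R_scope.

(* C is taken here as a normed space over R, so that [is_derive] and
   [continuous] apply to functions of a real variable with values in C^2.
   The norm carried by the product structure is the Euclidean one; it is used
   only for limits, while the Ulam bounds below are in terms of [norm_inf]. *)
Definition C2 : NormedModule R_AbsRing :=
  prod_NormedModule R_AbsRing C_R_NormedModule C_R_NormedModule.

Definition norm_inf (v : C2) : R := Rmax (Cmod (fst v)) (Cmod (snd v)).

Definition mat_vec (A : @matrix C 2 2) (v : C2) : C2 :=
  let a i j := coeff_mat (RtoC 0) A i j in
  (Cplus (Cmult (a 0%nat 0%nat) (fst v)) (Cmult (a 0%nat 1%nat) (snd v)),
   Cplus (Cmult (a 1%nat 0%nat) (fst v)) (Cmult (a 1%nat 1%nat) (snd v))).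

Definition diag2 (l1 l2 : C) : @matrix C 2 2 :=
  mk_matrix 2 2 (fun i j =>
    match i, j with
    | 0%nat, 0%nat => l1
    | 1%nat, 1%nat => l2
    | _, _ => RtoC 0
    end).

Definition sup_R (f : R -> R) : Rbar := Lub_Rbar (fun y => exists t, y = f t).

Definition is_solution (A : @matrix C 2 2) (x : R -> C2) : Prop :=
  forall t : R, is_derive x t (mat_vec A (x t)).

Definition is_Ulam_constant (A : @matrix C 2 2) (K : R) : Prop :=
  0 < K /\
  forall (eps : R) (phi dphi : R -> C2),
    0 < eps ->
    (forall t : R, is_derive phi t (dphi t)) ->
    (forall t : R, continuous dphi t) ->
    Rbar_le (sup_R (fun t => norm_inf (minus (dphi t) (mat_vec A (phi t)))))
            (Finite eps) ->
    exists x : R -> C2,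
      is_solution A x /\
      Rbar_le (sup_R (fun t => norm_inf (minus (phi t) (x t))))
              (Finite (K * eps)).

Definition Ulam_stable (A : @matrix C 2 2) : Prop :=
  exists K : R, is_Ulam_constant A K.

Definition is_best_Ulam_constant (A : @matrix C 2 2) (K : R) : Prop :=
  is_Ulam_constant A K /\
  forall K' : R, is_Ulam_constant A K' -> K <= K'.

(* Main.v *)
Require Import Defs.
From Stdlib Require Import Lra.

(* The system decouples into two scalar equations [x' = l x].  For [Re l > 0]
   and an [eps]-approximate solution [f], the function [h t = e^(-l t) f t]
   satisfies [|h' t| <= eps e^(-t Re l)], hence converges to some [c] at [+oo]
   with [|h t - c| <= eps e^(-t Re l) / Re l]; thus [c e^(l t)] stays within
   [eps / Re l] of [f].  The case [Re l < 0] follows by reversing time.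
   Conversely [e^(i t Im l) / Re l] is a 1-approximate solution of constant
   modulus [1 / |Re l|], and the only solution at bounded distance from it is
   [0]. *)

(** * Derivatives of maps into product spaces *)

(** The pair is the sum of [f] and [g] composed with the linear injections [u -> (u, 0)] and
    [v -> (0, v)], so the chain and sum rules apply. *)
Lemma is_derive_pair {U V : NormedModule R_AbsRing} (f : R -> U) (g : R -> V)
  (t : R) (df : U) (dg : V) :
  is_derive f t df -> is_derive g t dg ->
  @is_derive R_AbsRing (prod_NormedModule R_AbsRing U V)
    (fun s => (f s, g s)) t (df, dg).
Proof.
intros Hf Hg.
assert (Li : is_linear (fun u : U =>
    ((u, zero) : prod_NormedModule R_AbsRing U V))).
{ apply (is_linear_prod (fun u : U => u) (fun _ : U => zero : V)).
  - apply is_linear_id.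
  - apply is_linear_zero. }
assert (Lj : is_linear (fun v : V =>
    ((zero, v) : prod_NormedModule R_AbsRing U V))).
{ apply (is_linear_prod (fun _ : V => zero : U) (fun v : V => v)).
  - apply is_linear_zero.
  - apply is_linear_id. }
assert (Df := filterdiff_comp' f _ t _ _ Hf (filterdiff_linear _ Li)).
assert (Dg := filterdiff_comp' g _ t _ _ Hg (filterdiff_linear _ Lj)).
assert (D := filterdiff_plus_fct _ _ _ _ Df Dg).
unfold is_derive.
eapply filterdiff_ext_lin.
- eapply filterdiff_ext; [| exact D].
  intros s. simpl. unfold plus; simpl. unfold prod_plus; simpl.
  now rewrite plus_zero_r, plus_zero_l.
- intros s. simpl. unfold plus; simpl. unfold prod_plus; simpl.
  rewrite plus_zero_r, plus_zero_l. reflexivity.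
Qed.

Lemma is_derive_fst {U V : NormedModule R_AbsRing}
  (f : R -> prod_NormedModule R_AbsRing U V) (t : R)
  (d : prod_NormedModule R_AbsRing U V) :
  is_derive f t d -> is_derive (fun s => fst (f s)) t (fst d).
Proof.
intros Hf.
assert (Df := filterdiff_comp' f _ t _ _ Hf
  (filterdiff_linear _ (@is_linear_fst _ U V))).
unfold is_derive. eapply filterdiff_ext_lin; [exact Df |].
intros s; reflexivity.
Qed.

Lemma is_derive_snd {U V : NormedModule R_AbsRing}
  (f : R -> prod_NormedModule R_AbsRing U V) (t : R)
  (d : prod_NormedModule R_AbsRing U V) :
  is_derive f t d -> is_derive (fun s => snd (f s)) t (snd d).
Proof.
intros Hf.
assert (Df := filterdiff_comp' f _ t _ _ Hf
  (filterdiff_linear _ (@is_linear_snd _ U V))).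
unfold is_derive. eapply filterdiff_ext_lin; [exact Df |].
intros s; reflexivity.
Qed.

(** * Calculus of complex functions of a real variable *)

Notation is_derive_C := (@is_derive R_AbsRing C_R_NormedModule).

Lemma is_derive_Re (f : R -> C) (t : R) (d : C) :
  is_derive_C f t d -> is_derive (fun s => Re (f s)) t (Re d).
Proof. apply (@is_derive_fst R_NormedModule R_NormedModule). Qed.

Lemma is_derive_Im (f : R -> C) (t : R) (d : C) :
  is_derive_C f t d -> is_derive (fun s => Im (f s)) t (Im d).
Proof. apply (@is_derive_snd R_NormedModule R_NormedModule). Qed.

Lemma is_derive_Re_Im (f : R -> C) (t : R) (d : C) :
  is_derive (fun s => Re (f s)) t (Re d) ->
  is_derive (fun s => Im (f s)) t (Im d) ->
  is_derive_C f t d.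
Proof.
intros H1 H2.
assert (H := is_derive_pair (U := R_NormedModule) (V := R_NormedModule)
  _ _ _ _ _ H1 H2).
rewrite (surjective_pairing d).
refine (is_derive_ext _ _ _ _ _ H).
intros s. symmetry. apply (surjective_pairing (f s)).
Qed.

Lemma is_derive_Rmult (f g : R -> R) (t df dg : R) :
  is_derive f t df -> is_derive g t dg ->
  is_derive (fun s => f s * g s) t (df * g t + f t * dg).
Proof. intros Hf Hg. exact (is_derive_mult f g t df dg Hf Hg Rmult_comm). Qed.

(** The derivative is taken over the reals, so the product is expanded into real and imaginary parts
    and the real product rule is used on each. *)
Lemma is_derive_Cmult (f g : R -> C) (t : R) (df dg : C) :
  is_derive_C f t df -> is_derive_C g t dg ->
  is_derive_C (fun s => f s * g s)%C t (df * g t + f t * dg)%C.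
Proof.
intros Hf Hg.
assert (f1 := is_derive_Re _ _ _ Hf). assert (f2 := is_derive_Im _ _ _ Hf).
assert (g1 := is_derive_Re _ _ _ Hg). assert (g2 := is_derive_Im _ _ _ Hg).
apply is_derive_Re_Im.
- apply (is_derive_ext (fun s => Re (f s) * Re (g s) - Im (f s) * Im (g s)));
    [reflexivity |].
  evar_last.
  + exact (is_derive_minus _ _ _ _ _ (is_derive_Rmult _ _ _ _ _ f1 g1)
      (is_derive_Rmult _ _ _ _ _ f2 g2)).
  + unfold minus, plus, opp, Re, Im; simpl; ring.
- apply (is_derive_ext (fun s => Re (f s) * Im (g s) + Im (f s) * Re (g s)));
    [reflexivity |].
  evar_last.
  + exact (is_derive_plus _ _ _ _ _ (is_derive_Rmult _ _ _ _ _ f1 g2)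
      (is_derive_Rmult _ _ _ _ _ f2 g1)).
  + unfold plus, Re, Im; simpl; ring.
Qed.

Lemma is_derive_Cconst (c : C) (t : R) : is_derive_C (fun _ => c) t (RtoC 0).
Proof. apply (@is_derive_const R_AbsRing C_R_NormedModule). Qed.

(** This is [e^(l t)] in Cartesian form, which leaves only real [exp], [cos] and [sin] to
    differentiate. *)
Definition cexp (l : C) (t : R) : C :=
  (exp (Re l * t) * cos (Im l * t), exp (Re l * t) * sin (Im l * t)).

Lemma is_derive_cexp (l : C) (t : R) : is_derive_C (cexp l) t (l * cexp l t)%C.
Proof.
apply is_derive_Re_Im; unfold cexp, Re, Im; simpl; auto_derive; trivial; ring.
Qed.

Lemma Cmod_cexp (l : C) (t : R) : Cmod (cexp l t) = exp (Re l * t).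
Proof.
assert (H := sin2_cos2 (Im l * t)). unfold Rsqr in H.
unfold Cmod, cexp; simpl fst; simpl snd.
transitivity (sqrt (exp (Re l * t) ^ 2)).
- f_equal. rewrite <- (Rmult_1_r (exp (Re l * t) ^ 2)), <- H. ring.
- apply sqrt_pow2. left; apply exp_pos.
Qed.

(** Lets the integrating factor [e^(-l t)] be undone. *)
Lemma cexp_opp (l : C) (t : R) : (cexp l t * cexp (- l) t)%C = RtoC 1.
Proof.
unfold cexp, Cmult, RtoC, Re, Im; simpl.
rewrite !Ropp_mult_distr_l_reverse, cos_neg, sin_neg, exp_Ropp.
assert (H := sin2_cos2 (snd l * t)). unfold Rsqr in H.
assert (E := exp_pos (fst l * t)).
f_equal; [rewrite <- H |]; field; lra.
Qed.

(** * Mean value inequality and limits at infinity *)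

Lemma nondecreasing_of_derive (f df : R -> R) :
  (forall t, is_derive f t (df t)) -> (forall t, 0 <= df t) ->
  forall s t, s <= t -> f s <= f t.
Proof.
intros Hf Hd s t Hst.
destruct (MVT_gen f s t df) as [c [_ Hc]].
- intros; apply Hf.
- intros x _. apply continuity_pt_filterlim.
  apply (ex_derive_continuous f). eexists; apply Hf.
- assert (0 <= df c * (t - s)) by (apply Rmult_le_pos; [apply Hd | lra]).
  lra.
Qed.

(** Cauchy-Schwarz in the plane: the left side is the real part of [u * Cconj v]. *)
Lemma Re_mul_Im_mul_le_Cmod (u v : C) :
  Re u * Re v + Im u * Im v <= Cmod u * Cmod v.
Proof.
assert (H := re_le_Cmod (u * Cconj v)).
rewrite Cmod_mult, Cmod_conj in H.
assert (H' := Rle_abs (Re (u * Cconj v))).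
unfold Re, Im, Cconj, Cmult in *; simpl in *. lra.
Qed.

(* The mean value inequality reduces to the real case by projecting [h] on the
   direction [u] of its increment. *)
Lemma Cmod_increment_le (h dh : R -> C) (G dG : R -> R) :
  (forall t, is_derive_C h t (dh t)) -> (forall t, is_derive G t (dG t)) ->
  (forall t, Cmod (dh t) <= dG t) ->
  forall s t, s <= t -> Cmod (h t - h s)%C <= G t - G s.
Proof.
intros Hh HG Hle s t Hst.
assert (HGm : G s <= G t).
{ apply (nondecreasing_of_derive G dG); trivial.
  intros r. eapply Rle_trans; [apply Cmod_ge_0 | apply Hle]. }
set (u := (h t - h s)%C).
destruct (Req_dec (Cmod u) 0) as [-> | Hu]; [lra |].
assert (Hu0 : 0 < Cmod u) by (assert (H := Cmod_ge_0 u); lra).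
(* By Cauchy-Schwarz, [|u| G - <u, h>] has nonnegative derivative. Since [u] is the increment of
   [h], the inner product grows by [|u|^2] from [s] to [t], and one factor [|u|] cancels at the
   end. *)
assert (Hm : Cmod u * G s - (Re u * Re (h s) + Im u * Im (h s)) <=
             Cmod u * G t - (Re u * Re (h t) + Im u * Im (h t))).
{ apply (nondecreasing_of_derive
    (fun r => Cmod u * G r - (Re u * Re (h r) + Im u * Im (h r)))
    (fun r => Cmod u * dG r - (Re u * Re (dh r) + Im u * Im (dh r))));
    trivial; intros r.
  - assert (h1 := is_derive_Re _ _ _ (Hh r)).
    assert (h2 := is_derive_Im _ _ _ (Hh r)).
    apply (is_derive_minus (fun r => Cmod u * G r)
      (fun r => Re u * Re (h r) + Im u * Im (h r))).
    + apply is_derive_scal, HG.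
    + apply (is_derive_plus (fun r => Re u * Re (h r))
        (fun r => Im u * Im (h r))); now apply is_derive_scal.
  - assert (H := Re_mul_Im_mul_le_Cmod u (dh r)).
    assert (Cmod u * Cmod (dh r) <= Cmod u * dG r)
      by (apply Rmult_le_compat_l; [lra | apply Hle]).
    lra. }
assert (Hsq := Cmod2_alt u).
assert (E1 : Re u = Re (h t) - Re (h s)) by reflexivity.
assert (E2 : Im u = Im (h t) - Im (h s)) by reflexivity.
apply Rmult_le_reg_l with (Cmod u); trivial.
replace (Cmod u * Cmod u) with (Cmod u ^ 2) by ring.
rewrite Hsq.
replace (Re u ^ 2 + Im u ^ 2) with
  (Re u * (Re (h t) - Re (h s)) + Im u * (Im (h t) - Im (h s)))
  by (rewrite <- E1, <- E2; ring).
lra.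
Qed.

(** Since [G] converges, it is Cauchy at [+oo], and [f] inherits this because [G] dominates its
    increments; completeness of the reals gives the limit. *)
Lemma is_lim_of_increment_le (f G : R -> R) (L : R) :
  is_lim G p_infty L ->
  (forall s t, s <= t -> Rabs (f t - f s) <= G t - G s) ->
  exists c : R, is_lim f p_infty c.
Proof.
intros HG Hf.
assert (Hc : exists y : R, filterlim f (Rbar_locally p_infty) (locally y)).
{ apply (proj1 (filterlim_locally_cauchy (U := R_CompleteSpace)
    (F := Rbar_locally p_infty) f)).
  intros eps.
  (* On this set any two values of [G] differ by less than [eps]. *)
  exists (fun t => Rabs (G t - L) < eps / 2). split.
  - assert (He : 0 < eps / 2) by (assert (H := cond_pos eps); lra).
    exact (proj1 (filterlim_locally (F := Rbar_locally p_infty) G L) HG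
      (mkposreal _ He)).
  - intros u v Hu Hv.
    change (Rabs (f v - f u) < eps).
    apply Rabs_def2 in Hu. apply Rabs_def2 in Hv.
    destruct (Rle_dec u v) as [Huv | Huv].
    + assert (H := Hf u v Huv). lra.
    + assert (H := Hf v u ltac:(lra)). rewrite Rabs_minus_sym. lra. }
destruct Hc as [c Hc]. exists c. exact Hc.
Qed.

(** The real and imaginary parts converge separately, but bounding them separately would lose a
    constant factor. The sharp bound comes from letting [t] tend to [+oo] in the increment bound
    projected on the single direction [u = h s - c]. *)
Lemma limit_at_infinity_of_increment_le (h : R -> C) (G : R -> R) (L : R) :
  is_lim G p_infty L ->
  (forall s t, s <= t -> Cmod (h t - h s)%C <= G t - G s) ->
  exists c : C, forall s, Cmod (h s - c)%C <= L - G s.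
Proof.
intros HG Hh.
assert (Hc : forall z : C, Rabs (Re z) <= Cmod z /\ Rabs (Im z) <= Cmod z).
{ intros z. assert (H := Rmax_Cmod z).
  split; eapply Rle_trans; try apply H; [apply Rmax_l | apply Rmax_r]. }
destruct (is_lim_of_increment_le (fun t => Re (h t)) G L HG) as [c1 H1].
{ intros s t Hst. eapply Rle_trans; [| apply (Hh s t Hst)].
  exact (proj1 (Hc (h t - h s)%C)). }
destruct (is_lim_of_increment_le (fun t => Im (h t)) G L HG) as [c2 H2].
{ intros s t Hst. eapply Rle_trans; [| apply (Hh s t Hst)].
  exact (proj2 (Hc (h t - h s)%C)). }
exists (c1, c2). intros s.
set (u := (h s - (c1, c2))%C).
assert (HL : is_lim
    (fun t => Re u * (Re (h s) - Re (h t)) + Im u * (Im (h s) - Im (h t)))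
    p_infty (Re u * (Re (h s) - c1) + Im u * (Im (h s) - c2))).
{ apply (is_lim_plus' (fun t => Re u * (Re (h s) - Re (h t)))
    (fun t => Im u * (Im (h s) - Im (h t)))).
  - apply (is_lim_scal_l (fun t => Re (h s) - Re (h t)) (Re u) p_infty
      (Re (h s) - c1)).
    apply is_lim_minus'; [apply is_lim_const | exact H1].
  - apply (is_lim_scal_l (fun t => Im (h s) - Im (h t)) (Im u) p_infty
      (Im (h s) - c2)).
    apply is_lim_minus'; [apply is_lim_const | exact H2]. }
assert (HR : is_lim (fun t => Cmod u * (G t - G s)) p_infty
    (Cmod u * (L - G s))).
{ apply (is_lim_scal_l (fun t => G t - G s) (Cmod u) p_infty (L - G s)).
  apply is_lim_minus'; [exact HG | apply is_lim_const]. }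
assert (Hle : Rbar_le (Re u * (Re (h s) - c1) + Im u * (Im (h s) - c2))
    (Cmod u * (L - G s))).
{ refine (is_lim_le_loc _ _ p_infty _ _ _ HL HR).
  exists s. intros t Hst.
  eapply Rle_trans; [apply (Re_mul_Im_mul_le_Cmod u (h s - h t)%C) |].
  apply Rmult_le_compat_l; [apply Cmod_ge_0 |].
  rewrite <- Cmod_opp.
  replace (- (h s - h t))%C with (h t - h s)%C by ring.
  apply Hh. now left. }
(* The components of [h s - c] are those of [u], so the limit of the projections is [|u|^2]. *)
change (Re u * Re u + Im u * Im u <= Cmod u * (L - G s)) in Hle.
assert (Hsq := Cmod2_alt u).
(* If [u = 0], division by [|u|] is impossible; the claim then reduces to [G s <= L], which holds
   because [G] is nondecreasing with limit [L]. *)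
destruct (Req_dec (Cmod u) 0) as [E | E].
- rewrite E.
  assert (HG' : Rbar_le (G s) L).
  { refine (is_lim_le_loc (fun _ => G s) G p_infty _ _ _ (is_lim_const _ _) HG).
    exists s. intros t Hst. assert (H := Hh s t (Rlt_le _ _ Hst)).
    assert (H' := Cmod_ge_0 (h t - h s)%C). lra. }
  simpl in HG'. lra.
- assert (0 < Cmod u) by (assert (H := Cmod_ge_0 u); lra).
  apply Rmult_le_reg_l with (Cmod u); trivial.
  replace (Cmod u * Cmod u) with (Cmod u ^ 2) by ring.
  rewrite Hsq. lra.
Qed.

(** * Stability of the scalar equation *)

Lemma is_derive_Cscal_cexp (c l : C) (t : R) :
  is_derive_C (fun s => c * cexp l s)%C t (l * (c * cexp l t))%C.
Proof.
replace (l * (c * cexp l t))%C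
  with (RtoC 0 * cexp l t + c * (l * cexp l t))%C by ring.
apply (is_derive_Cmult (fun _ => c)).
- apply is_derive_Cconst.
- apply is_derive_cexp.
Qed.

Lemma scalar_Ulam_pos (l : C) (f df : R -> C) (eps : R) :
  0 < Re l -> (forall t, is_derive_C f t (df t)) ->
  (forall t, Cmod (df t - l * f t)%C <= eps) ->
  exists x : R -> C, (forall t, is_derive_C x t (l * x t)%C) /\
    forall t, Cmod (f t - x t)%C <= eps / Re l.
Proof.
intros Hl Hf He.
set (h := fun t => (cexp (- l) t * f t)%C).
(* The antiderivative of [eps * e^(-t Re l)] that tends to 0 at [+oo], so that [0 - G s] is exactly
   the bound wanted for [|h s - c|]. *)
set (G := fun t => - (eps / Re l) * exp (- Re l * t)).
destruct (limit_at_infinity_of_increment_le h G 0) as [c Hc].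
- replace (Finite 0) with (Rbar_mult (- (eps / Re l)) 0)
    by (simpl; now rewrite Rmult_0_r).
  apply is_lim_scal_l.
  apply (is_lim_comp exp (fun t => - Re l * t) p_infty 0 m_infty).
  + apply is_lim_exp_m.
  + evar_last; [apply is_lim_scal_l, is_lim_id |].
    simpl. destruct (Rle_dec 0 (- Re l)) as [H | H]; [exfalso; lra | easy].
  + now exists 0.
- apply (Cmod_increment_le h (fun t => cexp (- l) t * (df t - l * f t))%C
    G (fun t => exp (- Re l * t) * eps)).
  + intros t.
    replace (cexp (- l) t * (df t - l * f t))%C
      with ((- l * cexp (- l) t) * f t + cexp (- l) t * df t)%C by ring.
    apply is_derive_Cmult; [apply is_derive_cexp | apply Hf].
  + intros t. unfold G. auto_derive; trivial. field. lra.
  + intros t. rewrite Cmod_mult, Cmod_cexp.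
    apply Rmult_le_compat_l; [left; apply exp_pos | apply He].
- exists (fun t => c * cexp l t)%C. split.
  + intros t. apply is_derive_Cscal_cexp.
  + intros t.
    (* Multiplying back by [e^(l t)], of modulus [e^(t Re l)], cancels the decay of [G] and leaves
       the constant [eps / Re l]. *)
    replace (f t - c * cexp l t)%C with (cexp l t * (h t - c))%C.
    * rewrite Cmod_mult, Cmod_cexp.
      apply Rle_trans with (exp (Re l * t) * (0 - G t)).
      -- apply Rmult_le_compat_l; [left; apply exp_pos | apply Hc].
      -- unfold G. rewrite Ropp_mult_distr_l_reverse with (r1 := Re l), exp_Ropp.
         right. field. split; [lra | apply Rgt_not_eq, exp_pos].
    * unfold h.
      replace (cexp l t * (cexp (- l) t * f t - c))%C with
        ((cexp l t * cexp (- l) t) * f t - c * cexp l t)%C by ring.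
      rewrite cexp_opp. ring.
Qed.

Lemma is_derive_C_opp_arg (f : R -> C) (t : R) (d : C) :
  is_derive_C f (- t) d -> is_derive_C (fun s => f (- s)) t (- d)%C.
Proof.
intros Hf.
assert (H : is_derive Ropp t (-1)) by (auto_derive; trivial; ring).
assert (D := is_derive_comp (V := C_R_NormedModule) f Ropp t d (-1) Hf H).
replace (- d)%C with (scal (-1) d : C_R_NormedModule); [exact D |].
apply injective_projections; simpl; unfold scal; simpl; unfold mult; simpl; ring.
Qed.

Lemma scalar_Ulam (l : C) (f df : R -> C) (eps : R) :
  Re l <> 0 -> (forall t, is_derive_C f t (df t)) ->
  (forall t, Cmod (df t - l * f t)%C <= eps) ->
  exists x : R -> C, (forall t, is_derive_C x t (l * x t)%C) /\
    forall t, Cmod (f t - x t)%C <= eps / Rabs (Re l).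
Proof.
intros Hl Hf He.
destruct (Rlt_dec 0 (Re l)) as [Hp | Hn].
- rewrite Rabs_pos_eq by lra. now apply scalar_Ulam_pos with df.
- assert (Hn' : Re l < 0) by lra.
  (* The reversed function has derivative [- df (- t)], so its defect for [- l] is the opposite of
     the defect of [f] at [- t]. *)
  destruct (scalar_Ulam_pos (- l) (fun t => f (- t)) (fun t => - df (- t)%R)%C eps)
    as [x [Hx Hfx]].
  + unfold Re in *; simpl; lra.
  + intros t. apply is_derive_C_opp_arg, Hf.
  + intros t.
    replace (- df (- t)%R - - l * f (- t)%R)%C
      with (- (df (- t)%R - l * f (- t)%R))%C by ring.
    rewrite Cmod_opp. apply He.
  + exists (fun t => x (- t)). split.
    * intros t. replace (l * x (- t)%R)%C with (- (- l * x (- t)%R))%C by ring.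
      apply is_derive_C_opp_arg, Hx.
    * intros t. rewrite Rabs_left by lra.
      generalize (Hfx (- t)). now rewrite Ropp_involutive.
Qed.

(** * Exact and bounded solutions of the scalar equation *)

(** The product [e^(-l t) x t] has derivative 0, hence is constant by the mean value inequality with
    zero majorant. *)
Lemma solution_eq_cexp (l : C) (x : R -> C) :
  (forall t, is_derive_C x t (l * x t)%C) -> forall t, x t = (x 0%R * cexp l t)%C.
Proof.
intros Hx.
set (h := fun t => (cexp (- l) t * x t)%C).
assert (Hh : forall s t, s <= t -> (h t - h s)%C = RtoC 0).
{ intros s t Hst. apply Cmod_eq_0, Rle_antisym; [| apply Cmod_ge_0].
  replace 0 with (0 - 0) by ring.
  apply (Cmod_increment_le h (fun _ => RtoC 0) (fun _ => 0) (fun _ => 0));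
    trivial.
  - intros r.
    replace (RtoC 0) with ((- l * cexp (- l) r) * x r + cexp (- l) r * (l * x r))%C
      by ring.
    apply is_derive_Cmult; [apply is_derive_cexp | apply Hx].
  - intros r. apply (@is_derive_const R_AbsRing R_NormedModule).
  - intros r. rewrite Cmod_0. lra. }
assert (h0 : h 0 = x 0).
{ unfold h, cexp. rewrite !Rmult_0_r, exp_0, cos_0, sin_0.
  apply injective_projections; simpl; ring. }
intros t.
assert (E : h t = h 0).
{ destruct (Rle_dec 0 t) as [H | H].
  - replace (h t) with (h 0%R + (h t - h 0%R))%C by ring. rewrite Hh by trivial. ring.
  - replace (h t) with (h 0%R - (h 0%R - h t))%C by ring. rewrite Hh by lra. ring. }
rewrite <- h0, <- E. unfold h.
replace (cexp (- l) t * x t * cexp l t)%C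
  with ((cexp l t * cexp (- l) t) * x t)%C by ring.
rewrite cexp_opp. ring.
Qed.

(** A nonzero solution has modulus [|x 0| e^(t Re l)], unbounded in one direction of time. *)
Lemma bounded_solution_eq_0 (l : C) (x : R -> C) (M : R) :
  Re l <> 0 -> (forall t, is_derive_C x t (l * x t)%C) ->
  (forall t, Cmod (x t) <= M) -> x 0 = RtoC 0.
Proof.
intros Hl Hx HM.
apply Cmod_eq_0.
destruct (Req_dec (Cmod (x 0)) 0) as [E | E]; trivial. exfalso.
assert (Hp : 0 < Cmod (x 0)) by (assert (H := Cmod_ge_0 (x 0)); lra).
(* For either sign of [Re l], the exponent at this time is [M / |x 0|]; then [e^y >= 1 + y] gives
   the contradiction [|x 0| + M <= M]. *)
assert (H := HM (M / Cmod (x 0) / Re l)).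
rewrite (solution_eq_cexp l x Hx), Cmod_mult, Cmod_cexp in H.
replace (Re l * (M / Cmod (x 0) / Re l)) with (M / Cmod (x 0)) in H
  by (field; lra).
assert (H' := exp_ineq1_le (M / Cmod (x 0))).
assert (Cmod (x 0) * (1 + M / Cmod (x 0)) <= M).
{ eapply Rle_trans; [| exact H]. apply Rmult_le_compat_l; lra. }
replace (Cmod (x 0) * (1 + M / Cmod (x 0))) with (Cmod (x 0) + M) in H0
  by (field; lra).
lra.
Qed.

(** * Reduction of the system to its components *)

Lemma sup_R_le (f : R -> R) (M : R) :
  Rbar_le (sup_R f) M <-> forall t, f t <= M.
Proof.
unfold sup_R.
destruct (Lub_Rbar_correct (fun y => exists t, y = f t)) as [Hub Hlub].
split.
- intros H t. assert (H' := Hub (f t) (ex_intro _ t eq_refl)).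
  exact (Rbar_le_trans (f t) _ M H' H).
- intros H. apply Hlub. intros y [t ->]. apply H.
Qed.

Lemma mat_vec_diag2 (l1 l2 : C) (v : C2) :
  mat_vec (diag2 l1 l2) v = ((l1 * fst v)%C, (l2 * snd v)%C).
Proof. unfold mat_vec; cbn. f_equal; ring. Qed.

Lemma norm_inf_le (v : C2) (M : R) :
  norm_inf v <= M <-> Cmod (fst v) <= M /\ Cmod (snd v) <= M.
Proof.
unfold norm_inf. split.
- intros H; split; eapply Rle_trans; try exact H; [apply Rmax_l | apply Rmax_r].
- intros [H1 H2]; now apply Rmax_lub.
Qed.

(** Each component is approximated by its own scalar solution; in the maximum norm the two errors
    combine into the larger of the two constants. *)
Lemma diag2_Ulam_constant (l1 l2 : C) :
  Re l1 <> 0 -> Re l2 <> 0 ->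
  is_Ulam_constant (diag2 l1 l2) (Rmax (1 / Rabs (Re l1)) (1 / Rabs (Re l2))).
Proof.
intros h1 h2. split.
- eapply Rlt_le_trans; [| apply Rmax_l].
  apply Rdiv_lt_0_compat; [lra | now apply Rabs_pos_lt].
- intros eps phi dphi Heps Hphi _ Hsup.
  assert (Hd := proj1 (sup_R_le _ _) Hsup).
  assert (Hd' : forall t, Cmod (fst (dphi t) - l1 * fst (phi t))%C <= eps /\
                     Cmod (snd (dphi t) - l2 * snd (phi t))%C <= eps).
  { intros t. assert (H := Hd t). cbv beta in H. rewrite mat_vec_diag2 in H.
    exact (proj1 (norm_inf_le _ _) H). }
  destruct (scalar_Ulam l1 (fun t => fst (phi t)) (fun t => fst (dphi t)) eps h1)
    as [x [Hx Bx]].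
  { intros t. apply (is_derive_fst phi), Hphi. }
  { intros t; apply Hd'. }
  destruct (scalar_Ulam l2 (fun t => snd (phi t)) (fun t => snd (dphi t)) eps h2)
    as [y [Hy By]].
  { intros t. apply (is_derive_snd phi), Hphi. }
  { intros t; apply Hd'. }
  exists (fun t => (x t, y t)). split.
  + intros t. rewrite mat_vec_diag2.
    apply (is_derive_pair (U := C_R_NormedModule) (V := C_R_NormedModule) x y);
      [apply Hx | apply Hy].
  + apply sup_R_le. intros t. apply norm_inf_le.
    split.
    * eapply Rle_trans; [apply (Bx t) |].
      unfold Rdiv at 1. rewrite Rmult_comm.
      apply Rmult_le_compat_r; [lra |].
      rewrite <- Rdiv_1_l. apply Rmax_l.
    * eapply Rle_trans; [apply (By t) |].
      unfold Rdiv at 1. rewrite Rmult_comm.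
      apply Rmult_le_compat_r; [lra |].
      rewrite <- Rdiv_1_l. apply Rmax_r.
Qed.

(** * Optimality of the constant *)

(* An extremal approximate solution: [rotation l] has constant modulus
   [1 / |Re l|] and satisfies [x' = l x] up to an error of modulus exactly 1. *)
Definition rotation (l : C) (t : R) : C :=
  (RtoC (/ Re l) * cexp (0, Im l) t)%C.

Lemma Cmod_rotation (l : C) (t : R) : Cmod (rotation l t) = / Rabs (Re l).
Proof.
unfold rotation. rewrite Cmod_mult, Cmod_cexp, Cmod_R, Rabs_inv.
simpl. rewrite Rmult_0_l, exp_0. ring.
Qed.

(** The factor [i Im l - l] equals [- Re l], whose modulus cancels that of [rotation l t]. *)
Lemma rotation_defect (l : C) (t : R) : Re l <> 0 ->
  Cmod ((0, Im l) * rotation l t - l * rotation l t)%C = 1.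
Proof.
intros Hl.
replace ((0, Im l) * rotation l t - l * rotation l t)%C
  with (- RtoC (Re l) * rotation l t)%C.
- rewrite Cmod_mult, Cmod_opp, Cmod_R, Cmod_rotation.
  field. now apply Rabs_no_R0.
- destruct l as [a b]. unfold Re, Im; simpl fst; simpl snd.
  apply injective_projections; simpl; ring.
Qed.

Lemma is_derive_rotation (l : C) (t : R) :
  is_derive_C (rotation l) t ((0, Im l) * rotation l t)%C.
Proof. apply is_derive_Cscal_cexp. Qed.

(** Yields the continuity of the derivative that a test function must have. *)
Lemma is_derive_rotation_derive (l : C) (t : R) :
  is_derive_C (fun s => (0, Im l) * rotation l s)%C t
    ((0, Im l) * ((0, Im l) * rotation l t))%C.
Proof.
replace ((0, Im l) * ((0, Im l) * rotation l t))%C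
  with (RtoC 0 * rotation l t + (0, Im l) * ((0, Im l) * rotation l t))%C
  by ring.
apply (is_derive_Cmult (fun _ => (0, Im l))).
- apply is_derive_Cconst.
- apply is_derive_rotation.
Qed.

(** A solution near the bounded [rotation l] is itself bounded, so it vanishes at 0, where its
    distance to [rotation l] is then [1 / |Re l|]. *)
Lemma rotation_lower_bound (l : C) (x : R -> C) (K : R) :
  Re l <> 0 -> (forall t, is_derive_C x t (l * x t)%C) ->
  (forall t, Cmod (rotation l t - x t)%C <= K) -> 1 / Rabs (Re l) <= K.
Proof.
intros Hl Hx HK.
assert (x0 : x 0 = RtoC 0).
{ apply (bounded_solution_eq_0 l x (/ Rabs (Re l) + K) Hl Hx).
  intros t.
  replace (x t) with (rotation l t + - (rotation l t - x t))%C by ring.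
  eapply Rle_trans; [apply Cmod_triangle |].
  rewrite Cmod_opp, Cmod_rotation. apply Rplus_le_compat_l, HK. }
assert (H := HK 0). rewrite x0 in H.
replace (rotation l 0%R - RtoC 0)%C with (rotation l 0%R) in H by ring.
rewrite Cmod_rotation in H. lra.
Qed.

Lemma diag2_Ulam_constant_ge (l1 l2 : C) (K : R) :
  Re l1 <> 0 -> Re l2 <> 0 -> is_Ulam_constant (diag2 l1 l2) K ->
  Rmax (1 / Rabs (Re l1)) (1 / Rabs (Re l2)) <= K.
Proof.
intros h1 h2 [_ HK].
(* Rotations in both components at once, with [eps = 1]: this one test function yields both lower
   bounds. *)
destruct (HK 1 (fun t => (rotation l1 t, rotation l2 t))
  (fun t => (((0, Im l1) * rotation l1 t)%C, ((0, Im l2) * rotation l2 t)%C)))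
  as [x [Hx Bx]].
- lra.
- intros t.
  apply (is_derive_pair (U := C_R_NormedModule) (V := C_R_NormedModule)
    (rotation l1) (rotation l2)); apply is_derive_rotation.
- intros t.
  apply (ex_derive_continuous (V := C2)). eexists.
  apply (is_derive_pair (U := C_R_NormedModule) (V := C_R_NormedModule)
    (fun s => (0, Im l1) * rotation l1 s)%C
    (fun s => (0, Im l2) * rotation l2 s)%C);
    apply is_derive_rotation_derive.
- apply sup_R_le. intros t. rewrite mat_vec_diag2. apply norm_inf_le.
  split; right; now apply rotation_defect.
- assert (B := proj1 (sup_R_le _ _) Bx).
  assert (B' : forall t, Cmod (rotation l1 t - fst (x t))%C <= K /\
                    Cmod (rotation l2 t - snd (x t))%C <= K).
  { intros t. assert (H := B t). cbv beta in H. rewrite Rmult_1_r in H.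
    exact (proj1 (norm_inf_le _ _) H). }
  apply Rmax_lub.
  + apply (rotation_lower_bound l1 (fun t => fst (x t))); trivial; intros t.
    * assert (D := is_derive_fst x t _ (Hx t)).
      now rewrite mat_vec_diag2 in D.
    * apply B'.
  + apply (rotation_lower_bound l2 (fun t => snd (x t))); trivial; intros t.
    * assert (D := is_derive_snd x t _ (Hx t)).
      now rewrite mat_vec_diag2 in D.
    * apply B'.
Qed.

Theorem corollary3p4 (lambda1 lambda2 : C)
  (hre : Re lambda1 * Re lambda2 <> 0) :
  Ulam_stable (diag2 lambda1 lambda2) /\
  is_best_Ulam_constant (diag2 lambda1 lambda2)
    (Rmax (1 / Rabs (Re lambda1)) (1 / Rabs (Re lambda2))).
Proof.
assert (h1 : Re lambda1 <> 0) by (intros E; apply hre; rewrite E; ring).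
assert (h2 : Re lambda2 <> 0) by (intros E; apply hre; rewrite E; ring).
assert (HU := diag2_Ulam_constant lambda1 lambda2 h1 h2).
split; [eexists; exact HU |].
split; [exact HU |].
intros K HK. now apply diag2_Ulam_constant_ge.
Qed.
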